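(* Let $A=\{1,\dots,t\}$ be a finite set, let $k>1$ be an integer, let $\mathcal{C}$ be a clone on $A$ containing a $k$-edge operation, and let $\mathbf{A}=(A,\mathcal{C})$. Let $L$ be the set of lengths $|\mathbf{a}|$ of words $\mathbf{a}\in A^+$ such that, for some $(c,d)\in A^2$, $\mathbf{a}$ is a minimal element of $\lambda(\mathcal{C},(c,d))$ with respect to $\le_{\mathrm{E}}$. Then $L$ is finite, so $m:=\max(L)$ (with $m:=1$ if $L=\emptyset$) is a natural number, and $\mathcal{C}$ equals the set of all finitary operations on $A$ that preserve the relation $\mathcal{C}^{[m]}\subseteq A^{A^m}$ and every subuniverse of $\mathbf{A}^{k-1}$.
   Context: A clone on $A$ is a set of finitary operations on $A$ closed under composition and containing all projections; $\mathcal{C}^{[n]}$ denotes its $n$-ary members, viewed as elements of $A^{A^n}$, so $\mathcal{C}^{[m]}$ is a finitary relation on $A$ indexed by $A^m$. An operation $f:A^r\to A$ preserves a relation $R\subseteq A^I$ ($I$ finite) if $R$ is closed under $f$ applied coordinatewise; in particular $f$ preserves $\mathcal{C}^{[m]}$ iff $x\mapsto f(g_1(x),\dots,g_r(x))$ lies in $\mathcal{C}^{[m]}$ for all $g_1,\dots,g_r\in\mathcal{C}^{[m]}$. A $k$-edge operation ($k\ge2$) is $t:A^{k+1}\to A$ with $t(y,y,x,\dots,x)=t(y,x,y,x,\dots,x)=x$ and $t(x,\dots,x,y,x,\dots,x)=x$ ($y$ in position $i$) for each $i\in\{4,\dots,k+1\}$, for all $x,y$. $A^+=\bigcup_{n\ge1}A^n$,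 $|\mathbf{a}|$ is the length of $\mathbf{a}$. $<_{\mathrm{lex}}$ is the strict lexicographic order on $A^n$ induced by $1<\dots<t$. For $\mathbf{a}\in A^n$, $\varphi(\mathcal{C},\mathbf{a}):=\{(f(\mathbf{a}),g(\mathbf{a})) : f,g\in\mathcal{C}^{[n]},\ f(\mathbf{c})=g(\mathbf{c})\ \forall\mathbf{c}<_{\mathrm{lex}}\mathbf{a}\}$ and $\lambda(\mathcal{C},(c,d)):=\{\mathbf{a}\in A^+ : (c,d)\notin\varphi(\mathcal{C},\mathbf{a})\}$. $\mathrm{firstOcc}(\mathbf{a},b)$ is $0$ if $b$ does not occur in $\mathbf{a}$, otherwise the least $i$ with $a_i=b$; $(a_1,\dots,a_m)\le_{\mathrm{E}}(b_1,\dots,b_n)$ means there is a strictly increasing $h:\{1,\dots,m\}\to\{1,\dots,n\}$ with $a_i=b_{h(i)}$ for all $i$, $\{a_1,\dots,a_m\}=\{b_1,\dots,b_n\}$, and $h(\mathrm{firstOcc}(\mathbf{a},c))=\mathrm{firstOcc}(\mathbf{b},c)$ for all $c\in\{a_1,\dots,a_m\}$. *)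

(* Defs.v *)
From mathcomp Require Import all_boot.
Set Implicit Arguments. Unset Strict Implicit. Unset Printing Implicit Defensive.

(* Carrier A = {1,...,t} is represented by 'I_t = {0,...,t-1} with the same
   (natural) order.  An n-ary operation is a finite function A^n -> A. *)
Definition tup (t n : nat) := {ffun 'I_n -> 'I_t}.
Definition op (t n : nat) := {ffun tup t n -> 'I_t}.

Definition opfamily (t : nat) := forall n : nat, op t n -> Prop.

Definition is_clone t (C : opfamily t) : Prop :=
  (forall f : op t 0, ~ C 0 f) /\
  (forall n (i : 'I_n), C n [ffun x : tup t n => x i]) /\
  (forall n m (f : op t n) (g : 'I_n -> op t m),
      0 < n -> 0 < m -> C n f -> (forall i, C m (g i)) ->
      C m [ffun x : tup t m => f [ffun i => g i x]]).

Definition is_edge_op t (k : nat) (e : op t k.+1) : Prop :=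
  forall x y : 'I_t,
    e [ffun i : 'I_k.+1 => if (i == 0 :> nat) || (i == 1 :> nat) then y else x] = x /\
    e [ffun i : 'I_k.+1 => if (i == 0 :> nat) || (i == 2 :> nat) then y else x] = x /\
    (forall j : 'I_k.+1, 3 <= j ->
       e [ffun i : 'I_k.+1 => if i == j then y else x] = x).

Definition preserves t (I : finType) n (f : op t n) (R : {ffun I -> 'I_t} -> Prop) :=
  forall rows : 'I_n -> {ffun I -> 'I_t}, (forall i, R (rows i)) ->
    R [ffun j : I => f [ffun i => rows i j]].

Definition subuniverse t (C : opfamily t) p (B : tup t p -> Prop) :=
  forall n (f : op t n), 0 < n -> C n f -> preserves f B.

Definition lexlt t n (c a : tup t n) : Prop :=
  exists i : 'I_n, (forall j : 'I_n, j < i -> c j = a j) /\ c i < a i.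

Definition wtup t (a : seq 'I_t) : tup t (size a) :=
  [ffun i => tnth (in_tuple a) i].

Definition in_phi t (C : opfamily t) (a : seq 'I_t) (c d : 'I_t) : Prop :=
  exists f g : op t (size a),
    C (size a) f /\ C (size a) g /\
    (forall x, lexlt x (wtup a) -> f x = g x) /\
    f (wtup a) = c /\ g (wtup a) = d.

Definition in_lambda t (C : opfamily t) (c d : 'I_t) (a : seq 'I_t) : Prop :=
  0 < size a /\ ~ in_phi C a c d.

(* a <=_E b, with 0-based indices (index c a = firstOcc(a,c) - 1) *)
Definition leE t (a b : seq 'I_t) : Prop :=
  exists h : nat -> nat,
    (forall i, i < size a -> h i < size b /\ forall x0, nth x0 a i = nth x0 b (h i)) /\
    (forall i j, i < j < size a -> h i < h j) /\
    (forall x, (x \in a) = (x \in b)) /\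
    (forall x, x \in a -> h (index x a) = index x b).

Definition inL t (C : opfamily t) (l : nat) : Prop :=
  exists (a : seq 'I_t) (c d : 'I_t),
    size a = l /\ in_lambda C c d a /\
    (forall b, in_lambda C c d b -> leE b a -> b = a).

(* Main.v *)
(** The clone [D] of operations preserving [C^[m]] has the same members as [C]
    in arity at most [m], hence the same forks [phi] at words of length at most
    [m].  The sets [lambda D (c, d)] are upward closed for [<=_E] and the minimal
    elements of [lambda C (c, d)] have length at most [m], so [C] and [D] have the
    same forks everywhere.  With an edge operation, an element [g] of a power of
    [A] belongs to a subuniverse [F] as soon as [F] realises the forks that [g]
    forms with elements of [F] and the projections of [g] to [k - 1] coordinates.
    Finiteness of [L] is Higman's lemma for words whose letters are decorated so
    that the subword order refines [<=_E]. *)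
Require Import Defs.
From mathcomp Require Import all_boot.
From Stdlib Require Import ClassicalEpsilon.
Set Implicit Arguments. Unset Strict Implicit. Unset Printing Implicit Defensive.

(** * Higman's lemma *)

Definition infinitely_often (P : nat -> Prop) :=
  forall n, exists2 m, n <= m & P m.

Lemma infinitely_often_or (P Q : nat -> Prop) :
  (forall n, P n \/ Q n) -> infinitely_often P \/ infinitely_often Q.
Proof.
move=> PQ; have [|nP] := classic (infinitely_often P); first by left.
right=> n; apply: NNPP => nQ; apply: nP => k.
exists (maxn n k); first exact: leq_maxr.
by case: (PQ (maxn n k)) => // Qm; case: nQ; exists (maxn n k); rewrite ?leq_maxl.
Qed.

Lemma infinitely_often_subsequence (P : nat -> Prop) : infinitely_often P ->
  exists2 s : nat -> nat, {homo s : i j / i < j} & forall i, P (s i).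
Proof.
move=> infP.
have exm n : exists m, n <= m /\ P m by have [m] := infP n; exists m.
pose g n := proj1_sig (constructive_indefinite_description _ (exm n)).
have gP n : n <= g n /\ P (g n).
  exact: proj2_sig (constructive_indefinite_description _ (exm n)).
exists (fun n => iter n (fun i => g i.+1) (g 0)).
  by apply: homo_ltn => [x y z|i]; [exact: ltn_trans | exact: (gP _).1].
by case=> [|i]; apply: (gP _).2.
Qed.

Section Higman.
Variable T : finType.
Implicit Types (f : nat -> seq T) (S : {set T}).

(** A whole chain rather than one comparable pair: a chain of prefixes can then be thinned again to
    make the suffixes comparable too. *)
Definition has_subword_chain f := exists2 s : nat -> nat,
  {homo s : i j / i < j} & forall i j, i < j -> subseq (f (s i)) (f (s j)).

Lemma has_subword_chain_sub f (s : nat -> nat) :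
  {homo s : i j / i < j} -> has_subword_chain (f \o s) -> has_subword_chain f.
Proof.
move=> smono [s' s'mono ch]; exists (s \o s') => // i j ij.
by apply: smono; apply: s'mono.
Qed.

(* A word avoiding [c :: v] either avoids the letter [c] or is [x ++ c :: y],
   where [x] avoids [c] and [y] avoids [v]. *)
Lemma avoiding_has_subword_chain S :
  (forall c, c \in S -> forall f, (forall n, all (mem (S :\ c)) (f n)) ->
     has_subword_chain f) ->
  forall v, all (mem S) v -> forall f, (forall n, all (mem S) (f n)) ->
    (forall n, ~~ subseq v (f n)) -> has_subword_chain f.
Proof.
move=> IHS; elim=> [_ f _ /(_ 0)|c v IHv]; first by rewrite sub0seq.
move=> /= /andP[cS vS] f fS favoid.
have noc w : all (mem S) w -> c \notin w -> all (mem (S :\ c)) w.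
  move=> /allP wS cw; apply/allP => x xw /=.
  have /= xS := wS _ xw; rewrite in_setD1 xS andbT.
  by apply: contraNneq cw => <-.
have [] : infinitely_often (fun n => c \notin f n) \/
          infinitely_often (fun n => c \in f n).
  by apply: infinitely_often_or => n; case: (c \in f n); [right|left].
- case/infinitely_often_subsequence => s smono sP.
  by apply: (has_subword_chain_sub smono); apply: (IHS c cS) => n; exact: noc (fS _) (sP _).
- case/infinitely_often_subsequence => s smono sP.
  apply: (has_subword_chain_sub smono).
  pose x n := take (index c (f (s n))) (f (s n)).
  pose y n := drop (index c (f (s n))).+1 (f (s n)).
  have fE n : f (s n) = x n ++ c :: y n.
    rewrite -{1}(cat_take_drop (index c (f (s n))) (f (s n))).
    by rewrite (drop_nth c) ?index_mem // nth_index.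
  have xyS n : all (mem S) (x n) && all (mem S) (y n).
    by have := fS (s n); rewrite fE all_cat /= => /and3P[-> _ ->].
  have [n|s1 s1mono ch1] := IHS c cS x.
    apply: noc; first by case/andP: (xyS n).
    by apply/negP => /index_ltn; rewrite ltnn.
  have [n|n|s2 s2mono ch2] := IHv vS (y \o s1).
  + by case/andP: (xyS (s1 n)).
  + apply: contra (favoid (s (s1 n))) => vy; rewrite fE.
    by apply: (@cat_subseq _ [::] (c :: v)); rewrite ?sub0seq //= eqxx.
  exists (s1 \o s2) => [i j ij|i j ij]; first by apply: s1mono; apply: s2mono.
  rewrite /= !fE; apply: cat_subseq; first by apply: ch1; apply: s2mono.
  by rewrite /= eqxx; apply: ch2.
Qed.

(** Induction on the size of an alphabet [S] containing all letters. If some [f i] fails to embed in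
    infinitely many [f j], these avoid [f i] and the previous lemma applies. Otherwise each [f i]
    embeds in a later term, and iterating this choice builds the chain. *)
Lemma higman f : has_subword_chain f.
Proof.
suff IH n S : #|S| <= n -> forall g, (forall i, all (mem S) (g i)) ->
    has_subword_chain g.
  by apply: (IH _ [set: T] (leqnn _)) => i; apply/allP => x _; rewrite /= inE.
elim: n S => [|n IHn] S leSn {}f fS.
  have f0 i : f i = [::].
    case: (f i) (fS i) => //= x w /andP[xS _].
    by move: leSn; rewrite leqn0 cards_eq0 => /eqP S0; rewrite S0 inE in xS.
  by exists id => // i j _; rewrite !f0.
have IHS c : c \in S -> forall g, (forall i, all (mem (S :\ c)) (g i)) ->
    has_subword_chain g.
  by move=> cS g; apply: IHn; move: leSn; rewrite (cardsD1 c S) cS.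
have [[i]|noi] :=
  classic (exists i, infinitely_often (fun j => ~~ subseq (f i) (f j))).
  case/infinitely_often_subsequence => s smono sP.
  apply: (has_subword_chain_sub smono).
  by apply: (avoiding_has_subword_chain IHS (fS i)) => // j; apply: fS.
have next i : exists j, i < j /\ subseq (f i) (f j).
  apply: NNPP => nj; apply: noi; exists i => k.
  exists (maxn k i.+1); first exact: leq_maxl.
  by apply/negP => sub; apply: nj; exists (maxn k i.+1); rewrite leq_maxr.
pose g i := proj1_sig (constructive_indefinite_description _ (next i)).
have gP i : i < g i /\ subseq (f i) (f (g i)).
  exact: proj2_sig (constructive_indefinite_description _ (next i)).
pose s n := iter n g 0.
exists s.
  by apply: homo_ltn => [x y z|i]; [exact: ltn_trans | exact: (gP _).1].
apply: (@homo_ltn _ (f \o s) (fun u v => subseq u v)) => [x y z|i]; first exact: subseq_trans.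
exact: (gP _).2.
Qed.

End Higman.

(** * The order [leE] *)

Lemma subseq_embedding (T : eqType) (a b : seq T) : subseq a b ->
  exists h : nat -> nat,
    (forall i, i < size a -> h i < size b /\ forall x0, nth x0 a i = nth x0 b (h i)) /\
    (forall i j, i < j < size a -> h i < h j).
Proof.
elim: b a => [|y b IHb] [|x a] //=.
- by move=> _; exists id; split=> // i j; rewrite ltn0 andbF.
- by move=> _; exists id; split=> // i j; rewrite ltn0 andbF.
case: eqP => [<-|_] /IHb[h [hP hmono]].
  exists (fun i => if i is i'.+1 then (h i').+1 else 0); split.
    by case=> [|i] //= /hP.
  by case=> [|i] [|j] //= ij; apply: hmono.
by exists (fun i => (h i).+1); split=> [i /hP|i j /hmono].
Qed.

(* Flagging first occurrences forces an embedding of decorated words to respect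
   them; the set of all letters is recorded in every letter. *)
Definition decorate t (x0 : 'I_t) (s : seq 'I_t) : seq ('I_t * bool * {set 'I_t}) :=
  mkseq (fun i => (nth x0 s i, index (nth x0 s i) s == i, [set y in s])) (size s).

Lemma leE_decorate t (x0 : 'I_t) (a b : seq 'I_t) : 0 < size a ->
  subseq (decorate x0 a) (decorate x0 b) -> leE a b.
Proof.
move=> a0 /subseq_embedding[h]; rewrite !size_mkseq => -[hP hmono].
have hE i : i < size a -> [/\ h i < size b, nth x0 a i = nth x0 b (h i),
    (index (nth x0 a i) a == i) = (index (nth x0 b (h i)) b == h i)
    & [set y in a] = [set y in b]].
  by move=> ia; have [hb /(_ (x0, true, set0))] := hP i ia; rewrite !nth_mkseq // => -[].
exists h; split.
  move=> i ia; have [hb e _ _] := hE i ia; split=> // x1.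
  by rewrite (set_nth_default x0) // e; apply: set_nth_default.
split=> //; split.
  (* The set of all letters is read off position 0, which exists as [a] is nonempty. *)
  by move=> x; have [_ _ _ /setP/(_ x)] := hE 0 a0; rewrite !inE.
move=> x xa; have [_ e f _] := hE (index x a) (etrans (index_mem x a) xa).
by move: f; rewrite -e nth_index // eqxx => /esym/eqP.
Qed.

(** A strictly increasing [h] satisfies [i <= h i], and room for the remaining positions bounds
    [h i] above; for equal lengths [h] is the identity, so the words coincide. *)
Lemma leE_size t (a b : seq 'I_t) : leE a b -> a != b -> size a < size b.
Proof.
case=> h [hP [hmono _]] neq.
have hD d i : i + d < size a -> h i + d <= h (i + d).
  elim: d => [|d IHd]; rewrite ?addn0 // !addnS => lt.
  by rewrite (leq_ltn_trans (IHd (ltnW lt))) // hmono // ltnSn.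
have hlast i : i < size a -> h i + (size a).-1 < size b + i.
  move=> ia; have lt : i + ((size a).-1 - i) = (size a).-1.
    by rewrite subnKC // -ltnS (ltn_predK ia).
  have := hD ((size a).-1 - i) i; rewrite lt (ltn_predK ia) leqnn => /(_ isT) le1.
  have [|lt2 _] := hP (size a).-1; first by rewrite (ltn_predK ia).
  by rewrite -[X in _ + X]lt addnCA addnC ltn_add2r (leq_ltn_trans le1).
rewrite ltnNge; apply: contra neq => le; apply/eqP.
have sz : size a = size b.
  apply/eqP; rewrite eqn_leq le andbT; case: (posnP (size a)) => [-> //|a0].
  have [|lt _] := hP (size a).-1; first by rewrite (ltn_predK a0).
  have := hD (size a).-1 0; rewrite add0n (ltn_predK a0) leqnn => /(_ isT) le1.
  rewrite -(ltn_predK a0); apply: leq_ltn_trans lt.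
  exact: leq_trans (leq_addl _ _) le1.
case: a sz hP hD hlast {hmono le} => [|x0 a] sz hP hD hlast; first by case: b sz {hP hlast}.
apply: (@eq_from_nth _ x0) => // i ia.
have [_ ->] := hP i ia; congr nth; apply/eqP; rewrite eqn_leq; apply/andP; split.
  by have := hlast i ia; rewrite -sz /= addSn addnC ltnS leq_add2l.
by have := hD i 0 ia; apply: leq_trans; apply: leq_addl.
Qed.

(** [sigma] inverts [h] on its image and sends any other [j] to the first occurrence of [b_j] in
    [a]. If [x] drops below [a] first at [i], then [x] composed with [sigma] drops below [b] first
    at [h i]: an index [j < h i] outside the image has its first occurrence in [b] at or before [j],
    and [h] matches first occurrences, so [sigma j < i]. *)
Lemma leE_substitution t (a b : seq 'I_t) : leE a b ->
  exists sigma : 'I_(size b) -> 'I_(size a),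
    [ffun j => wtup a (sigma j)] = wtup b /\
    forall x, lexlt x (wtup a) -> lexlt [ffun j => x (sigma j)] (wtup b).
Proof.
case=> h [hP [hmono [content first]]].
have bj_a (j : 'I_(size b)) : index (tnth (in_tuple b) j) a < size a.
  by rewrite index_mem content mem_tnth.
pose sigma (j : 'I_(size b)) : 'I_(size a) :=
  if [pick i : 'I_(size a) | h i == j] is Some i then i else Ordinal (bj_a j).
have sigmaE (j : 'I_(size b)) : tnth (in_tuple a) (sigma j) = tnth (in_tuple b) j.
  have x0 := tnth (in_tuple b) j.
  rewrite /sigma; case: pickP => [i /eqP hi|_] /=.
    by rewrite !(tnth_nth x0) /= -hi; have [_ ->] := hP i (ltn_ord i).
  by rewrite (tnth_nth x0) /= nth_index // content mem_tnth.
have hlt (i i' : 'I_(size a)) : h i < h i' -> i < i'.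
  move=> lt; rewrite ltnNge; apply/negP; rewrite leq_eqVlt => /orP[/eqP e|lt'].
    by rewrite e ltnn in lt.
  by have := hmono i' i; rewrite lt' ltn_ord ltnNge (ltnW lt) => /(_ isT).
have sigma_lt (i : 'I_(size a)) (j : 'I_(size b)) : j < h i -> sigma j < i.
  rewrite /sigma; case: pickP => [i' /eqP <- /hlt //|_] lt.
  apply: hlt; rewrite /= first -?index_mem //.
  by apply: leq_ltn_trans lt; rewrite (tnth_nth (tnth (in_tuple b) j)) index_nth.
exists sigma; split; first by apply/ffunP => j; rewrite !ffunE sigmaE.
move=> x [i [eqx ltx]].
have hib : h i < size b by have [] := hP i (ltn_ord i).
have sigma_h : sigma (Ordinal hib) = i.
  rewrite /sigma; case: pickP => [i' /eqP /= e|/(_ i)]; last by rewrite /= eqxx.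
  apply: ord_inj; have [lt|lt|//] := ltngtP i' i.
    by have := hmono i' i; rewrite e ltnn lt ltn_ord => /(_ isT).
  by have := hmono i i'; rewrite e ltnn lt ltn_ord => /(_ isT).
exists (Ordinal hib); split=> [j /= ltj|].
  by rewrite !ffunE eqx ?sigma_lt // ffunE sigmaE.
by move: ltx; rewrite !ffunE sigma_h -sigmaE sigma_h.
Qed.

(** Minimal words of unbounded length for one pair [(c, d)] would contain a chain for [leE];
    minimality makes all its terms equal, while their lengths grow. *)
Lemma inL_bounded t (C : opfamily t) : exists N, forall l, inL C l -> l <= N.
Proof.
pose minimal c d a := in_lambda C c d a /\
  (forall b, in_lambda C c d b -> leE b a -> b = a).
have bnd (cd : 'I_t * 'I_t) :
    exists N, forall a, minimal cd.1 cd.2 a -> size a <= N.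
  case: cd => c d /=; apply: NNPP => unb.
  have ex n : exists a, minimal c d a /\ n < size a.
    apply: NNPP => na; apply: unb; exists n => a mina; rewrite leqNgt.
    by apply/negP => lt; apply: na; exists a.
  pose w n := proj1_sig (constructive_indefinite_description _ (ex n)).
  have wP n : minimal c d (w n) /\ n < size (w n).
    exact: proj2_sig (constructive_indefinite_description _ (ex n)).
  have [s smono ch] := higman (fun n => decorate c (w n)).
  have same j : w (s 0) = w (s j.+1).
    have [[[sz0 nphi] _] _] := wP (s 0); have [[_ mini] _] := wP (s j.+1).
    by apply: mini; [split | apply: (leE_decorate sz0); apply: ch].
  have s_ge j : j <= s j.
    by elim: j => // j IHj; apply: leq_ltn_trans IHj (smono _ _ _).
  have [_] := wP (s (size (w (s 0))).+1); rewrite -same ltnNge.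
  by rewrite (leq_trans (leqnSn _) (s_ge _)).
have [N NP] := fin_all_exists bnd.
exists (\max_cd N cd) => _ [a [c [d [<- mina]]]].
by apply: leq_trans (leq_bigmax (c, d)); apply: NP.
Qed.

(** * Lexicographic order *)

Definition lexltb t n (y x : tup t n) : bool :=
  [exists i : 'I_n, [forall j : 'I_n, (j < i) ==> (y j == x j)] && (y i < x i)].

Lemma lexltP t n (y x : tup t n) : reflect (lexlt y x) (lexltb y x).
Proof.
apply: (iffP existsP) => [[i /andP[/forallP e lt]]|[i [e lt]]]; exists i.
  by split=> // j ji; apply/eqP; apply: implyP (e j) ji.
by rewrite lt andbT; apply/forallP => j; apply/implyP => ji; rewrite e.
Qed.

Lemma lexlt_irr t n (x : tup t n) : ~ lexlt x x.
Proof. by case=> i [_]; rewrite ltnn. Qed.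

Lemma lexlt_trans t n (y x z : tup t n) : lexlt x y -> lexlt y z -> lexlt x z.
Proof.
case=> i [ei lti] [j [ej ltj]]; have [ij|ji|ij] := ltngtP i j.
- exists i; split=> [l li|]; last by rewrite -ej.
  by rewrite ei // ej // (ltn_trans li).
- exists j; split=> [l lj|]; last by rewrite ei.
  by rewrite ei ?(ltn_trans lj) // ej.
have {}ij := val_inj ij; subst j; exists i; split=> [l li|]; last exact: ltn_trans ltj.
by rewrite ei // ej.
Qed.

Lemma lexlt_total t n (x y : tup t n) : x <> y -> lexlt x y \/ lexlt y x.
Proof.
move=> neq; have [i0 di0] : exists i, x i != y i.
  apply/existsP; apply: contra_notT neq; rewrite negb_exists => /forallP e.
  by apply/ffunP => i; apply/eqP; have := e i; rewrite negbK.
case: (@arg_minnP _ i0 (fun i => x i != y i) (fun i => i : nat) di0) => i di mini.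
have e (j : 'I_n) : j < i -> x j = y j.
  by move=> ji; apply/eqP; apply: contraLR ji => /mini; rewrite leqNgt.
have := di; rewrite -val_eqE /= neq_ltn => /orP[lt|lt]; [left|right]; exists i.
  by split.
by split=> // j /e.
Qed.

(** Position in the lexicographic order, serving as the injective numbering [r] of coordinates in
    [fork_closure]. *)
Definition lexrank t n (x : tup t n) := #|[set y | lexltb y x]|.

Lemma lexlt_rank t n (x y : tup t n) : lexlt x y -> lexrank x < lexrank y.
Proof.
move=> xy; apply: proper_card; apply/properP; split.
  by apply/subsetP => z; rewrite !inE => /lexltP zx; apply/lexltP; apply: lexlt_trans xy.
exists x; rewrite inE; first exact/lexltP.
by apply/negP => /lexltP /lexlt_irr.
Qed.

Lemma lexrank_lt t n (x y : tup t n) : lexrank x < lexrank y -> lexlt x y.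
Proof.
move=> lt; have [e|/eqP/lexlt_total[//|/lexlt_rank]] := eqVneq x y.
  by rewrite e ltnn in lt.
by rewrite ltnNge (ltnW lt).
Qed.

Lemma lexrank_inj t n : injective (@lexrank t n).
Proof.
move=> x y e; have [//|/eqP/lexlt_total[] /lexlt_rank] := eqVneq x y.
  by rewrite e ltnn.
by rewrite e ltnn.
Qed.

(** * Edge operations and forks *)

Section Edge.
Variables (t k : nat) (e : op t k.+1).
Hypotheses (hk : 1 < k) (he : is_edge_op e).

(** This and the next two lemmas restate the edge identities as tests on the entries of an arbitrary
    row. *)
Lemma edge01 (z : tup t k.+1) a :
  (forall i : 'I_k.+1, 1 < i -> z i = a) ->
  (forall i j : 'I_k.+1, i <= 1 -> j <= 1 -> z i = z j) -> e z = a.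
Proof.
move=> za z01; rewrite -[RHS](he a (z ord0)).1; congr (e _).
apply/ffunP => i; rewrite ffunE.
case: i => [[|[|i]] lti] /=; try exact: z01; exact: za.
Qed.

Lemma edge02 (z : tup t k.+1) a :
  (forall i : 'I_k.+1, i != 0 :> nat -> i != 2 :> nat -> z i = a) ->
  (forall i : 'I_k.+1, i = 2 :> nat -> z i = z ord0) -> e z = a.
Proof.
move=> za z02; rewrite -[RHS](he a (z ord0)).2.1; congr (e _).
apply/ffunP => i; rewrite ffunE; case: eqP => [i0|/eqP i0] /=.
  by congr (z _); apply: val_inj.
by case: eqP => [/z02 //|/eqP i2]; exact: za.
Qed.

Lemma edge_ge3 (z : tup t k.+1) a (j : 'I_k.+1) : 2 < j ->
  (forall i, i != j -> z i = a) -> e z = a.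
Proof.
move=> j3 za; rewrite -[RHS]((he a (z j)).2.2 j j3); congr (e _).
by apply/ffunP => i; rewrite ffunE; case: eqP => [-> //|/eqP /za].
Qed.

Variables (I : finType) (r : I -> nat) (F : {ffun I -> 'I_t} -> Prop).
Hypotheses (r_inj : injective r) (Fe : preserves e F).
Variable g : {ffun I -> 'I_t}.
Hypothesis g_proj : forall p : 'I_(k - 1) -> I,
  exists2 f, F f & forall i, f (p i) = g (p i).

(* Induction on [T].  If [T] is large, drop from it one element at a time to get
   approximations [w i], [2 <= i <= k].  At [x], both [x0 = e (v, u, w2, ..., w2)]
   and [x1 = e (w2, f, w2, w3, ..., wk)] equal [e (b, a, b, ..., b)], where
   [a = f x] and [b = g x]; on [T], [x0 = w2] and [x1 = g].  Hence
   [e (x0, x1, w2, w3, ..., wk)] agrees with [g] on [T] and at [x]. *)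
Lemma fork_interpolation x f u v : F f -> (forall y, r y < r x -> f y = g y) ->
  F u -> F v -> (forall y, r y < r x -> u y = v y) -> u x = f x -> v x = g x ->
  forall T : {set I}, (forall y, y \in T -> r y < r x) ->
    exists2 w, F w & w x = g x /\ forall y, y \in T -> w y = g y.
Proof.
move=> Ff fg Fu Fv uv ux vx T.
move: {2}#|T| (leqnn #|T|) => n; elim: n T => [|n IHn] T leTn Tlt.
  have lt0 : 0 < k - 1 by rewrite subn_gt0.
  have [w Fw wP] := g_proj (fun=> x).
  exists w => //; split=> [|y]; first exact: wP (Ordinal lt0).
  by move: leTn; rewrite leqn0 cards_eq0 => /eqP->; rewrite inE.
have [leT|ltT] := leqP #|T| (k - 2).
  (* [T] fills at most [k - 2] of the [k - 1] indices; the default value places [x] at the last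
     one. *)
  have [w Fw wP] := g_proj (fun i => nth x (enum T) i).
  have lt2 : k - 2 < k - 1 by rewrite ltn_sub2l.
  exists w => //; split=> [|y yT].
    by have := wP (Ordinal lt2); rewrite /= nth_default // -cardE.
  have yT' : y \in enum T by rewrite mem_enum.
  have lti : index y (enum T) < k - 1.
    by apply: ltn_trans lt2; apply: leq_trans leT; rewrite cardE index_mem.
  by have := wP (Ordinal lti); rewrite /= nth_index.
(* Indices 2 to [k] pick distinct points of [T]. Truncation sends 0 and 1 to the point of 2; [q]
   uses [w i2] for all three. *)
pose tau (i : 'I_k.+1) := nth x (enum T) (i - 2).
have tau_lt (i : 'I_k.+1) : i - 2 < size (enum T).
  by rewrite -cardE (leq_ltn_trans _ ltT) // leq_sub2r // -ltnS.
have tauT i : tau i \in T by rewrite -mem_enum mem_nth.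
have tau_inj (i j : 'I_k.+1) : 1 < i -> 1 < j -> tau i = tau j -> i = j.
  move=> i2 j2 /eqP; rewrite nth_uniq ?enum_uniq // => /eqP e2.
  by apply: val_inj; rewrite /= -(subnK i2) -(subnK j2) e2.
have exw (i : 'I_k.+1) : exists w, [/\ F w, w x = g x
    & forall y, y \in T -> y != tau i -> w y = g y].
  have [||w Fw [wx wT]] := IHn (T :\ tau i).
  - by move: leTn; rewrite (cardsD1 (tau i) T) tauT.
  - by move=> y /setD1P[_ /Tlt].
  by exists w; split=> // y yT yi; apply: wT; rewrite in_setD1 yi.
have [w wP] := fin_all_exists exw.
pose i2 : 'I_k.+1 := Ordinal (hk : 2 < k.+1).
pose q (i : 'I_k.+1) := if i <= 2 then w i2 else w i.
have Fq i : F (q i) by rewrite /q; case: ifP => _; have [] := wP i2; have [] := wP i.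
have qx i : q i x = g x.
  by rewrite /q; case: ifP => _; have [_ e2 _] := wP i2; have [_ ei _] := wP i.
(* If [y = tau j] with [j > 2], only entry [j] can differ from [g y]. Otherwise only entries 0 and 2
   can, and both are [w i2 y]. *)
have eq_row (z : tup t k.+1) y : y \in T ->
    (forall i : 'I_k.+1, i = 1 :> nat -> z i = g y) ->
    (forall i : 'I_k.+1, i <> 1 :> nat -> z i = q i y) -> e z = g y.
  move=> yT z1 zq.
  have [/existsP[j /andP[j3 /eqP yj]]|noj] :=
    boolP [exists j : 'I_k.+1, (2 < j) && (y == tau j)].
    apply: (edge_ge3 j3) => i ij; have [/z1 //|/eqP i1] := eqVneq (i : nat) 1.
    rewrite (zq i i1) /q; case: leqP => [_|i3].
      have [_ _ ->] := wP i2; rewrite // yj; apply/eqP => /tau_inj => /(_ (ltnW j3) isT) e2.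
      by rewrite e2 in j3.
    have [_ _ ->] := wP i; rewrite // yj; apply/eqP => /tau_inj.
    by move=> /(_ (ltnW j3) (ltnW i3)) e2; rewrite e2 eqxx in ij.
  apply: edge02 => [i i0 in2|i ii2].
    have [/z1 //|/eqP i1] := eqVneq (i : nat) 1; rewrite (zq i i1) /q.
    have i3 : 2 < i by case: i i0 in2 i1 => [[|[|[|i]]]].
    rewrite leqNgt i3 /=; have [_ _ ->] := wP i => //.
    by apply: contraNneq noj => yi; apply/existsP; exists i; rewrite i3 yi eqxx.
  by rewrite !zq ?ii2 // /q ii2 leqnn.
pose x0 : {ffun I -> 'I_t} := [ffun y => e [ffun i : 'I_k.+1 =>
  (if i == 0 :> nat then v else if i == 1 :> nat then u else w i2) y]].
pose x1 : {ffun I -> 'I_t} := [ffun y => e [ffun i : 'I_k.+1 =>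
  (if i == 1 :> nat then f else q i) y]].
pose rows (i : 'I_k.+1) := if i == 0 :> nat then x0 else if i == 1 :> nat then x1 else q i.
have Fx0 : F x0.
  apply: (Fe (rows := fun i : 'I_k.+1 =>
    if i == 0 :> nat then v else if i == 1 :> nat then u else w i2)) => i.
  by case: ifP => // _; case: ifP => // _; have [] := wP i2.
have Fx1 : F x1.
  by apply: (Fe (rows := fun i : 'I_k.+1 => if i == 1 :> nat then f else q i)) => i; case: ifP.
have x0w y : y \in T -> x0 y = w i2 y.
  move=> /Tlt yx; rewrite ffunE; apply: edge01 => [[[|[|i]] lti]|i j i1 j1] //.
    by rewrite ffunE.
  by rewrite !ffunE; case: i i1 => [[|[|i]] lti] //; case: j j1 => [[|[|j]] ltj] //= _ _;
    rewrite uv.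
have x1g y : y \in T -> x1 y = g y.
  move=> yT; rewrite ffunE; apply: eq_row => // i; rewrite ffunE; last by case: eqP.
  by move=> ->; rewrite /= fg // Tlt.
exists [ffun y => e [ffun i => rows i y]].
  by apply: Fe => i; rewrite /rows; case: ifP => // _; case: ifP.
split.
  rewrite ffunE; have x01 : x0 x = x1 x.
    rewrite !ffunE; congr (e _); apply/ffunP => i; rewrite !ffunE.
    case: i => [[|[|i]] lti]; rewrite /= ?qx //.
    by have [_ -> _] := wP i2.
  apply: edge01 => [[[|[|i]] lti] _|i j i1 j1] //; first by rewrite ffunE /rows /= qx.
  by rewrite !ffunE /rows; case: i i1 => [[|[|i]] lti] //; case: j j1 => [[|[|j]] ltj].
move=> y yT; rewrite ffunE; apply: eq_row => // i; rewrite ffunE /rows.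
  by move=> ->; rewrite /= x1g.
by case: eqP => [i0|_]; [rewrite x0w // /q i0 | case: eqP].
Qed.

(** Agreement with [g] is extended one rank at a time, interpolating with [T] the set of all earlier
    coordinates. *)
Lemma fork_closure f0 : F f0 ->
  (forall x f, F f -> (forall y, r y < r x -> f y = g y) ->
     exists u v, [/\ F u, F v, forall y, r y < r x -> u y = v y, u x = f x & v x = g x]) ->
  F g.
Proof.
move=> Ff0 forks.
have step n : exists2 f, F f & forall y, r y < n -> f y = g y.
  elim: n => [|n [f Ff fg]]; first by exists f0.
  have [/existsP[x /eqP rx]|nox] := boolP [exists x, r x == n]; last first.
    exists f => // y; rewrite ltnS leq_eqVlt => /orP[ry|/fg //].
    by case/existsP: nox; exists y.
  rewrite -rx in fg; have [u [v [Fu Fv uv ux vx]]] := forks x f Ff fg.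
  have [y|w Fw [wx wT]] :=
    fork_interpolation Ff fg Fu Fv uv ux vx (T := [set y | r y < r x]).
    by rewrite inE.
  exists w => // y; rewrite -rx ltnS leq_eqVlt => /orP[/eqP/r_inj-> //|ry].
  by apply: wT; rewrite inE.
have [f Ff fg] := step (\max_x r x).+1.
suff -> : g = f by [].
by apply/ffunP => y; rewrite fg // ltnS leq_bigmax.
Qed.

End Edge.

(** * Clones *)

Definition forked t (C : opfamily t) n (x : tup t n) (c d : 'I_t) : Prop :=
  exists f g : op t n,
    C n f /\ C n g /\ (forall y, lexlt y x -> f y = g y) /\ f x = c /\ g x = d.

(** Quantifying over predicates on all lengths transports facts between [n] and [size a] without
    casts. *)
Lemma tup_word t n (x : tup t n) : exists2 a : seq 'I_t, size a = n &
  forall Q : (forall m, tup t m -> Prop), Q n x <-> Q (size a) (wtup a).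
Proof.
suff H (b : n.-tuple 'I_t) (Q : forall m, tup t m -> Prop) :
    Q n [ffun i => tnth b i] <-> Q (size b) (wtup b).
  exists [tuple x i | i < n]; first by rewrite size_tuple.
  move=> Q; rewrite -H; suff <- : x = [ffun i => tnth [tuple x i | i < n] i] by [].
  by apply/ffunP => i; rewrite ffunE tnth_mktuple.
case: b => s /= sz; have E := eqP sz; subst n.
suff -> : [ffun i => tnth (Tuple sz) i] = wtup s by [].
apply/ffunP => i; have x0 := tnth (in_tuple s) i.
by rewrite !ffunE !(tnth_nth x0).
Qed.

Definition closed_under_minors t (D : opfamily t) :=
  forall n m (f : op t n) (sigma : 'I_n -> 'I_m),
    D n f -> D m [ffun x : tup t m => f [ffun i => x (sigma i)]].

(** Both operations of a fork at [b] are pulled back along [sigma]; hence [in_lambda] is upward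
    closed. *)
Lemma in_phi_leE t (D : opfamily t) (a b : seq 'I_t) c d :
  closed_under_minors D -> leE a b -> in_phi D b c d -> in_phi D a c d.
Proof.
move=> Dminor /leE_substitution[sigma [sab slt]] [f [g [Df [Dg [fg [fb gb]]]]]].
exists [ffun x : tup t (size a) => f [ffun j => x (sigma j)]].
exists [ffun x : tup t (size a) => g [ffun j => x (sigma j)]].
by do !split; rewrite ?ffunE ?sab //; [exact: Dminor..|move=> x /slt/fg; rewrite !ffunE].
Qed.

(** * Operations preserving the m-ary part of a clone *)

Definition Pol t (I : finType) (R : {ffun I -> 'I_t} -> Prop) : opfamily t :=
  fun n f => preserves f R.

Lemma Pol_minor t (I : finType) (R : {ffun I -> 'I_t} -> Prop) :
  closed_under_minors (Pol R).
Proof.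
move=> n m f sigma Df rows Rrows.
have := Df (fun i => rows (sigma i)) (fun i => Rrows (sigma i)).
congr R; apply/ffunP => j; rewrite !ffunE; congr (f _).
by apply/ffunP => i; rewrite !ffunE.
Qed.

Lemma clone_Pol t (C : opfamily t) m n (f : op t n) : is_clone C ->
  0 < m -> 0 < n -> C n f -> Pol (C m) f.
Proof. by case=> _ [_ comp] m0 n0 Cf rows Crows; apply: comp. Qed.

(** Applying [f] to the first [l] of the [m] projections puts [f], padded with dummy variables, into
    [C m]. Substituting the last of [l] variables for the dummies recovers [f]. *)
Lemma Pol_clone_small t (C : opfamily t) m l (f : op t l) : is_clone C ->
  0 < l <= m -> Pol (C m) f -> C l f.
Proof.
case=> _ [proj comp] /andP[l0 lm] Df.
have Cm := Df (fun i => [ffun x : tup t m => x (widen_ord lm i)])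
  (fun i => proj m (widen_ord lm i)).
have lt_min (j : 'I_m) : minn j l.-1 < l.
  by rewrite -{2}(ltn_predK l0) ltnS geq_minr.
have := comp _ _ _ (fun j => [ffun x : tup t l => x (Ordinal (lt_min j))])
  (leq_trans l0 lm) l0 Cm (fun j => proj l _).
congr C; apply/ffunP => x; rewrite !ffunE; congr (f _); apply/ffunP => i.
rewrite !ffunE; congr (x _); apply: val_inj => /=; apply/minn_idPl.
by rewrite -ltnS (ltn_predK l0).
Qed.

(** Induction on the length of [a]. A minimal [a] in [in_lambda] has length at most [m], where
    [Pol (C m)] lies inside [C]. Below a non-minimal [a] lies a shorter [b] in [in_lambda]; the fork
    descends to [b] and induction contradicts this. *)
Lemma in_phi_Pol t (C : opfamily t) m (a : seq 'I_t) c d : is_clone C ->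
  (forall l, inL C l -> l <= m) -> 0 < size a ->
  in_phi (Pol (C m)) a c d -> in_phi C a c d.
Proof.
move=> hC Lm; have [n] := ubnP (size a); elim: n a => // n IHn a ltan a0 Dphi.
apply: NNPP => nphi.
have [mina|] := classic (forall b, in_lambda C c d b -> leE b a -> b = a).
  have am : size a <= m by apply: Lm; exists a, c, d.
  apply: nphi; have [f [g [Df [Dg fg]]]] := Dphi; exists f, g.
  have small h : Pol (C m) h -> C (size a) h.
    by apply: Pol_clone_small; rewrite // a0.
  by split; [exact: small | split; [exact: small | exact: fg]].
case=> b [b0 bphi] ba.
apply/eqP; apply: contra_notT bphi => neq; apply: IHn => //.
  by apply: leq_trans (leE_size ba neq) _.
exact: in_phi_leE (@Pol_minor _ _ _) ba Dphi.
Qed.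

(** This projection of [C n] to [p] points is used with [p = k - 1]: preserving it provides members
    of [C n] agreeing with [f] at those points. *)
Lemma clone_generated_subuniverse t (C : opfamily t) n p (x : 'I_p -> tup t n) :
  is_clone C -> 0 < n ->
  subuniverse C (fun b : tup t p => exists2 f, C n f & forall i, b i = f (x i)).
Proof.
case=> _ [_ comp] n0 l f l0 Cf rows /fin_all_exists2[g Cg gE].
exists [ffun y : tup t n => f [ffun i => g i y]]; first exact: comp.
by move=> i; rewrite !ffunE; congr (f _); apply/ffunP => j; rewrite !ffunE gE.
Qed.

Theorem theorem6p1 (t k : nat) (C : opfamily t) (hk : 1 < k)
    (hC : is_clone C) (hedge : exists e : op t k.+1, C k.+1 e /\ is_edge_op e) :
  (exists N, forall l, inL C l -> l <= N) /\
  (forall m : nat,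
     ((forall l, ~ inL C l) /\ m = 1) \/ (inL C m /\ forall l, inL C l -> l <= m) ->
     forall n (f : op t n), 0 < n ->
       (C n f <->
        (preserves f (fun g : op t m => C m g) /\
         forall B : tup t (k - 1) -> Prop, subuniverse C B -> preserves f B))).
Proof.
split; first exact: inL_bounded.
move=> m mL n f n0.
have [m0 Lm] : 0 < m /\ forall l, inL C l -> l <= m.
  case: mL => [[L0 ->]|[[a [c [d [<- [[a0 _] _]]]]] Lm]]; last by split.
  by split=> // l /L0.
split=> [Cf|[fC fB]].
  by split=> [|B subB]; [exact: (clone_Pol hC) | exact: subB].
have [e [Ce he]] := hedge.
have proj := hC.2.1; pose f0 : op t n := [ffun x : tup t n => x (Ordinal n0)].
(* Here [F] is [C n], a set of vectors indexed by [A^n], and the target [g] is [f]. *)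
apply: (fork_closure hk he (@lexrank_inj t n) _ _ (proj n (Ordinal n0))).
- exact: (clone_Pol hC).
- move=> p; have := fB _ (clone_generated_subuniverse (x := p) hC n0)
    (fun i => [ffun j => p j i]).
  case=> [i|h Ch hE].
    by exists [ffun y : tup t n => y i] => // j; rewrite !ffunE.
  exists h => // i; rewrite -hE ffunE; congr (f _).
  by apply/ffunP => j; rewrite !ffunE.
(* Both [h] and [f] preserve [C m], so they form a fork of [Pol (C m)] at [x]; [in_phi_Pol] realises
   the same values by a fork of [C]. *)
move=> x h Ch hf; have [a sz aE] := tup_word x.
have Dfork : forked (Pol (C m)) x (h x) (f x).
  exists h, f; do !split=> //; first exact: (clone_Pol hC).
  by move=> y /lexlt_rank; apply: hf.
have /(aE (fun n x => forked (Pol (C m)) x _ _)) phiD := Dfork.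
have /(aE (fun n x => forked C x _ _)) : in_phi C a (h x) (f x).
  by apply: (in_phi_Pol hC Lm) phiD; rewrite sz.
case=> u [v [Cu [Cv [uv [ux vx]]]]]; exists u, v; split=> // y lt.
by apply: uv; apply: lexrank_lt.
Qed.
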